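(* Let $S$ be a numerical semigroup such that $(\mathfrak{I}_0(S),\preceq)$ is a lattice, and let $I\in\mathfrak{I}_0(S)$. If $I$ is $\cap$-irreducible, then $I$ is $\wedge$-irreducible.
   Context: $\mathbb{N}$ denotes the set of non-negative integers. A numerical semigroup is a submonoid $S$ of $(\mathbb{N},+)$ with $\mathbb{N}\setminus S$ finite. A (relative) ideal of $S$ is a subset $I\subseteq\mathbb{Z}$ such that $I+S=I$ and $z+I\subseteq S$ for some integer $z$. An ideal $I$ is normalized if $\min(I)=0$; $\mathfrak{I}_0(S)$ denotes the (finite) set of normalized ideals of $S$. For ideals, $I+J=\{i+j : i\in I, j\in J\}$. For $I,J\in\mathfrak{I}_0(S)$, write $I\preceq J$ if there exists $K\in\mathfrak{I}_0(S)$ with $I+K=J$; this is a partial order. A poset is a lattice if every pair of elements has an infimum and a supremum; when $(\mathfrak{I}_0(S),\preceq)$ is a lattice, $\wedge$ denotes the infimum with respect to $\preceq$. The intersection of two normalized ideals of $S$ is again a normalized ideal of $S$. An ideal $I\in\mathfrak{I}_0(S)$ is $\cap$-irreducible if there are no $J,K\in\mathfrak{I}_0(S)\setminus\{I\}$ with $I=J\cap K$. It is $\wedge$-irreducible if there are no $J,K\in\mathfrak{I}_0(S)\setminus\{I\}$ with $I=J\wedge K$. *)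

(* Defs.v *)
From HB Require Import structures.
From mathcomp Require Import all_boot all_order all_algebra.
From mathcomp Require Import boolp classical_sets cardinality.

Set Implicit Arguments.
Unset Strict Implicit.
Unset Printing Implicit Defensive.

Import Order.TTheory GRing.Theory Num.Theory.
Local Open Scope classical_set_scope.
Local Open Scope ring_scope.

Definition sumset (A B : set int) : set int := [set a + b | a in A & b in B].

Record numericalSemigroup := NumericalSemigroup {
  ns_set :> set nat;
  ns0 : ns_set 0%N;
  nsD : forall m n, ns_set m -> ns_set n -> ns_set (m + n)%N;
  ns_cofinite : finite_set (~` ns_set) }.

Definition ns_int (S : numericalSemigroup) : set int := Posz @` S.

Definition relative_ideal (S : numericalSemigroup) (I : set int) : Prop :=
  sumset I (ns_int S) = I /\ exists z : int, sumset [set z] I `<=` ns_int S.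

(* A lower bound of [I] that belongs to [I]: this says min(I) = 0, and in
   particular excludes the empty set, which [relative_ideal] allows. *)
Definition normalized (I : set int) : Prop := I 0 /\ lbound I 0.

Record normIdeal (S : numericalSemigroup) := NormIdeal {
  ideal_set :> set int;
  ideal_relative : relative_ideal S ideal_set;
  ideal_normalized : normalized ideal_set }.

HB.instance Definition _ (S : numericalSemigroup) :=
  gen_eqMixin (normIdeal S).
HB.instance Definition _ (S : numericalSemigroup) :=
  gen_choiceMixin (normIdeal S).

Definition ideal_prec (S : numericalSemigroup) (I J : normIdeal S) : Prop :=
  exists K : normIdeal S, sumset I K = J.

Lemma normIdeal_inj (S : numericalSemigroup) (I J : normIdeal S) :
  I = J :> set int -> I = J.
Proof.
case: I J => [I rI nI] [J rJ nJ] /= IJ; subst J.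
by rewrite (Prop_irrelevance rI rJ) (Prop_irrelevance nI nJ).
Qed.

Lemma sumsetA (A B C : set int) :
  sumset A (sumset B C) = sumset (sumset A B) C.
Proof.
apply/seteqP; split => x /=.
- move=> [a Aa [_ [b Bb [c Cc <-]] <-]].
  by exists (a + b); [exists a => //; exists b|exists c => //; rewrite addrA].
- move=> [_ [a Aa [b Bb <-]] [c Cc <-]].
  by exists a => //; exists (b + c); [exists b => //; exists c|rewrite addrA].
Qed.

Lemma sub_sumsetl (S : numericalSemigroup) (A : set int) (K : normIdeal S) :
  A `<=` sumset A K.
Proof.
move=> a Aa; exists a => //; exists 0; last by rewrite addr0.
by have [] := ideal_normalized K.
Qed.

Lemma ns_int_relative (S : numericalSemigroup) : relative_ideal S (ns_int S).
Proof.
split; last first.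
  by exists 0 => _ [_ -> [x Sx <-]]; rewrite add0r.
apply/seteqP; split => x.
- move=> [_ [m Sm <-] [_ [n Sn <-] <-]].
  by exists (m + n)%N; [exact: nsD|rewrite PoszD].
- move=> Sx; exists x => //; exists 0; last by rewrite addr0.
  by exists 0%N => //; exact: ns0.
Qed.

Lemma ns_int_normalized (S : numericalSemigroup) : normalized (ns_int S).
Proof. by split=> [|_ [n _ <-] //]; exists 0%N => //; exact: ns0. Qed.

Lemma sumset_relative (S : numericalSemigroup) (I J : normIdeal S) :
  relative_ideal S (sumset I J).
Proof.
have [IS [y yI]] := ideal_relative I; have [JS [z zJ]] := ideal_relative J.
split; first by rewrite -sumsetA JS.
exists (y + z) => _ [_ -> [_ [i Ii [j Jj <-]] <-]].
have [|m Sm ym] := yI (y + i); first by exists y => //; exists i.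
have [|n Sn zn] := zJ (z + j); first by exists z => //; exists j.
by exists (m + n)%N; [exact: nsD|rewrite PoszD ym zn addrACA].
Qed.

Lemma sumset_normalized (S : numericalSemigroup) (I J : normIdeal S) :
  normalized (sumset I J).
Proof.
have [I0 Ige] := ideal_normalized I; have [J0 Jge] := ideal_normalized J.
split; first by exists 0 => //; exists 0 => //; rewrite addr0.
by move=> _ [i Ii [j Jj <-]]; apply: addr_ge0; [exact: Ige|exact: Jge].
Qed.

Fact normIdeal_display : Order.disp_t. Proof. exact. Qed.

Section NormIdealOrder.
Variable S : numericalSemigroup.

Let prec (I J : normIdeal S) : bool := `[< ideal_prec I J >].

Let prec_refl : reflexive prec.
Proof.
move=> I; apply/asboolP.
exists (NormIdeal (ns_int_relative S) (ns_int_normalized S)).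
by have [] := ideal_relative I.
Qed.

Let prec_anti : antisymmetric prec.
Proof.
move=> I J /andP[/asboolP[K IK] /asboolP[L JL]].
by apply: normIdeal_inj; apply/seteqP; split;
  [rewrite -IK|rewrite -JL]; exact: sub_sumsetl.
Qed.

Let prec_trans : transitive prec.
Proof.
move=> J I L /asboolP[K IK] /asboolP[K' JK']; apply/asboolP.
exists (NormIdeal (sumset_relative K K') (sumset_normalized K K')).
by rewrite /= sumsetA IK.
Qed.

HB.instance Definition _ := Order.Le_isPOrder.Build normIdeal_display
  (normIdeal S) prec_refl prec_anti prec_trans.

End NormIdealOrder.

Lemma ideal_leP (S : numericalSemigroup) (I J : normIdeal S) :
  reflect (ideal_prec I J) (I <= J)%O.
Proof. exact: asboolP. Qed.

Definition is_lattice d (T : porderType d) : Prop :=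
  forall x y : T,
    infimums [set x; y] !=set0 /\ supremums [set x; y] !=set0.

Definition cap_irreducible (S : numericalSemigroup) (I : normIdeal S) : Prop :=
  ~ exists J K : normIdeal S, [/\ J <> I, K <> I & I = J `&` K :> set int].

(* [infimums [set J; K]] has at most one element, so membership of [I] in it
   says that the meet of [J] and [K] exists and equals [I]. *)
Definition meet_irreducible (S : numericalSemigroup) (I : normIdeal S) : Prop :=
  ~ exists J K : normIdeal S,
      [/\ J <> I, K <> I & infimums [set J; K] I].

(* Main.v *)
Require Import Defs.
From mathcomp Require Import all_boot all_order all_algebra.
From mathcomp Require Import zify.
From mathcomp Require Import boolp classical_sets cardinality.

Set Implicit Arguments.
Unset Strict Implicit.
Unset Printing Implicit Defensive.

Import Order.TTheory GRing.Theory Num.Theory.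
Local Open Scope classical_set_scope.
Local Open Scope ring_scope.

(** A normalized ideal [I] other than the set of all nonnegative integers has
    a largest nonnegative gap [f], and [I `|` [set f]] is again a normalized
    ideal; it is the sum of [I] and the ideal [G] generated by 0 and [f],
    because every nonzero element of [I] carries [f] past the last gap. Two
    things follow.

    - If [J] is a normalized ideal strictly containing [I] and missing [f], then
      [I] is the intersection of [J] and [I `|` [set f]]. So when [I] is
      cap-irreducible, every strictly larger ideal contains [f]
      ([cap_irreducible_gap]).
    - If [J = I + A] contains [f], then [J + G = J], since [J] contains [f] and
      everything above it; hence [J = (I + G) + A], that is,
      [I + G] precedes [J] ([adjoin_gap_le]).

    Consequently, for [I] cap-irreducible, [I + G] lies below everything that
    lies strictly above [I], so [I] cannot be the infimum of two elements
    other than itself. *)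

Lemma ns_conductor (S : numericalSemigroup) :
  exists c : nat, forall n, (c <= n)%N -> ns_set S n.
Proof.
have /finite_seqP[s sE] := ns_cofinite S.
exists (\max_(i <- s) i).+1 => n cn; apply: contrapT => nS.
have : [set` s] n by rewrite -sE.
by move=> /= ns; have := @leq_bigmax_seq _ s xpredT id n ns isT; rewrite leqNgt cn.
Qed.

Section Ideals.
Variable S : numericalSemigroup.
Implicit Types I J A : normIdeal S.

Lemma ideal_mem0 I : ideal_set I 0. Proof. by case: (ideal_normalized I). Qed.

Lemma ideal_ge0 I (x : int) : ideal_set I x -> 0 <= x.
Proof. by case: (ideal_normalized I) => _; exact. Qed.

Lemma ideal_add I (x : int) (s : nat) :
  ideal_set I x -> ns_set S s -> ideal_set I (x + s%:Z).
Proof.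
move=> Ix Ss; have [<- _] := ideal_relative I.
by exists x => //; exists s%:Z => //; exists s.
Qed.

Lemma sumsetC (A B : set int) : sumset A B = sumset B A.
Proof.
by apply/seteqP; split=> _ [a Aa [b Bb <-]]; exists b => //; exists a => //;
  rewrite addrC.
Qed.

Lemma relative_ideal_nonneg (X : set int) :
    lbound X 0 -> (forall x s, X x -> ns_set S s -> X (x + s%:Z)) ->
  relative_ideal S X.
Proof.
move=> X0 XS; split.
  apply/seteqP; split=> [_ [x Xx [_ [s Ss <-] <-]]|x Xx]; first exact: XS.
  exists x => //; exists 0; last by rewrite addr0.
  by exists 0%N => //; exact: ns0.
(* Translating by the conductor moves every nonnegative integer into [S]. *)
have [c cS] := ns_conductor S; exists c%:Z => _ [_ -> [x Xx <-]].
have := X0 _ Xx; case: x Xx => // n _ _.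
by exists (c + n)%N; [apply: cS; lia|rewrite PoszD].
Qed.

Definition gen0 (f : nat) : set int :=
  ns_int S `|` [set f%:Z + s | s in ns_int S].

Lemma gen0_normalized f : normalized (gen0 f).
Proof.
split; first by left; exists 0%N => //; exact: ns0.
by move=> _ [[s _ <-]|[_ [s _ <-] <-]]; lia.
Qed.

Lemma gen0_relative f : relative_ideal S (gen0 f).
Proof.
apply: relative_ideal_nonneg; first by have [] := gen0_normalized f.
move=> _ t [[s Ss <-]|[_ [s Ss <-] <-]] St.
  by left; exists (s + t)%N; [exact: nsD|rewrite PoszD].
right; exists (s%:Z + t%:Z); last by rewrite addrA.
by exists (s + t)%N; [exact: nsD|rewrite PoszD].
Qed.

Definition gen0_ideal f := NormIdeal (gen0_relative f) (gen0_normalized f).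

(** For [f] the largest gap of [I] this is the union of [I] and [f]; writing it
    as a sum with [I] makes it comparable to [I] for the order of ideals. *)
Definition adjoin I f : normIdeal S :=
  NormIdeal (sumset_relative I (gen0_ideal f))
            (sumset_normalized I (gen0_ideal f)).

Definition largest_gap (X : set int) (f : nat) : Prop :=
  ~ X f%:Z /\ forall x : int, f%:Z < x -> X x.

(** The ideal [J] only serves to provide a nonnegative integer outside [I];
    the conductor of [S] bounds the gaps since [S] lies inside [I]. *)
Lemma largest_gap_ex I J : I `<=` J -> J <> I ->
  exists f, largest_gap I f.
Proof.
move=> IJ nJI.
have [x Jx nIx] : exists2 x, ideal_set J x & ~ ideal_set I x.
  apply: contrapT => h; apply: nJI; apply: normIdeal_inj.
  apply/seteqP; split=> // x Jx; apply: contrapT => nIx.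
  by apply: h; exists x.
have gap_ex : exists n : nat, `[< ~ ideal_set I n%:Z >].
  by have := ideal_ge0 Jx; case: x {Jx} nIx => // n nI _; exists n; apply/asboolP.
have [c cS] := ns_conductor S.
have gap_le (n : nat) : `[< ~ ideal_set I n%:Z >] -> (n <= c)%N.
  move/asboolP=> nIn; rewrite leqNgt; apply/negP => cn; apply: nIn.
  by rewrite -[n%:Z]add0r; apply: ideal_add (ideal_mem0 I) _; apply: cS; lia.
have [f /asboolP nIf fmax] := ex_maxnP gap_ex gap_le.
exists f; split=> // -[n fn|n]; last by lia.
by apply: contrapT => nIn; have := fmax n (asboolT nIn); lia.
Qed.

Lemma adjoin_mem I f : ideal_set (adjoin I f) f%:Z.
Proof.
exists 0; first exact: ideal_mem0.
exists f%:Z; last by rewrite add0r.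
right; exists 0; last by rewrite addr0.
by exists 0%N => //; exact: ns0.
Qed.

(** When [f] is the last gap of an ideal inside [J], the second alternative
    leaves only [x = f] outside [J]: adjoining [f] adds nothing else. *)
Lemma sumset_gen0 J f (x : int) :
  sumset J (gen0 f) x -> ideal_set J x \/ f%:Z <= x.
Proof.
move=> [j Jj [_ [[s Ss <-]|[_ [s Ss <-] <-]] <-]].
  by left; exact: ideal_add.
by right; have := ideal_ge0 Jj; lia.
Qed.

(** Otherwise [I] would be the intersection of [J] and [adjoin I f], two
    ideals that both differ from [I]. *)
Lemma cap_irreducible_gap I J f : largest_gap I f -> cap_irreducible I ->
  I `<=` J -> J <> I -> ideal_set J f%:Z.
Proof.
move=> [nIf fI] capI IJ nJI; apply: contrapT => nJf; apply: capI.
exists J, (adjoin I f); split=> //.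
  by move=> E; apply: nIf; rewrite -E; exact: adjoin_mem.
apply/seteqP; split=> [x Ix|x [Jx /sumset_gen0[//|]]].
  by split; [exact: IJ|exact: sub_sumsetl].
by rewrite le_eqVlt => /predU1P[xf|]; [rewrite -xf in Jx|exact: fI].
Qed.

Lemma ideal_le_sub I J : (I <= J)%O -> I `<=` J.
Proof. by move=> /ideal_leP[A <-]; exact: sub_sumsetl. Qed.

(** The ideal generated by 0 and [f] is absorbed by [J], so the cofactor that
    takes [I] to [J] also takes [adjoin I f] to [J]. *)
Lemma adjoin_gap_le I J f : largest_gap I f -> (I <= J)%O -> ideal_set J f%:Z ->
  (adjoin I f <= J)%O.
Proof.
move=> gf IJ Jf; have /ideal_leP[A IAJ] := IJ; apply/ideal_leP; exists A.
rewrite /= -sumsetA (sumsetC (gen0 f)) sumsetA IAJ.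
apply/seteqP; split=> x; last exact: (@sub_sumsetl S J (gen0_ideal f)).
move=> /sumset_gen0[//|]; rewrite le_eqVlt => /predU1P[<- //|fx].
by apply: (ideal_le_sub IJ); case: gf => _; exact.
Qed.

End Ideals.

Theorem proposition28 (S : numericalSemigroup)
    (latS : is_lattice (normIdeal S)) (I : normIdeal S) :
  cap_irreducible I -> meet_irreducible I.
Proof.
move=> capI [J [K [nJI nKI [IJK maxI]]]].
have IJ : (I <= J)%O by apply: IJK; left.
have IK : (I <= K)%O by apply: IJK; right.
have [f gf] := largest_gap_ex (ideal_le_sub IJ) nJI.
have adjoin_le (L : normIdeal S) : (I <= L)%O -> L <> I -> (adjoin I f <= L)%O.
  move=> IL nLI; apply: adjoin_gap_le => //.
  exact: cap_irreducible_gap gf capI (ideal_le_sub IL) nLI.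
have /ideal_le_sub adjI : (adjoin I f <= I)%O.
  by apply: maxI => _ [->|->]; exact: adjoin_le.
by case: gf => + _; apply; apply: adjI; exact: adjoin_mem.
Qed.
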